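(* Let $q$ be a complex number with $|q|<1$. For any nonnegative integer $n$ we have $$\frac{(q;q^{2})_{\infty}}{(q^{2};q^{2})_{\infty}}\sum_{j=0}^{2n}q^{j(j+1)/2}=1-(q;q^{2})_{n+1}\sum_{k=n+1}^{\infty}\frac{(q;q^{2})_{k-n-1}\,q^{(2n+2)k-n-1}}{(1-q^{2k})(q^{2};q^{2})_{k-1}}{k-1 \brack n}_{q^{2}}.$$
   Context: For complex $p$ with $|p|<1$ and complex $z$, $(z;p)_{\infty}:=\prod_{m=0}^{\infty}(1-zp^{m})$. For a nonnegative integer $l$, $(z;p)_{l}:=\frac{(z;p)_{\infty}}{(zp^{l};p)_{\infty}}$, that is, $(z;p)_{l}=\prod_{m=0}^{l-1}(1-zp^{m})$ (with $(z;p)_0=1$). The $p$-binomial coefficient is ${M \brack N}_{p}:=\frac{(p;p)_{M}}{(p;p)_{N}(p;p)_{M-N}}$ if $0\le N\le M$, and $0$ otherwise; here it is used with $p=q^{2}$. *)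

(* Defs.v *)
From Stdlib Require Import Reals Lra Lia Arith.
From Coquelicot Require Import Coquelicot.
Open Scope C_scope.

(* (z;p)_l as a finite product rather than the quotient (z;p)_oo / (z p^l;p)_oo,
   whose denominator can vanish. *)
Fixpoint qpoch (z p : C) (l : nat) : C :=
  match l with
  | O => 1
  | S l' => qpoch z p l' * (1 - z * p ^ l')
  end.

(* (z;p)_oo, the limit of the partial products.  [iota] returns that limit when
   it exists, and [qpoch_inf_correct] shows that it does for |p| < 1. *)
Definition qpoch_inf (z p : C) : C :=
  iota (T := C_CompleteNormedModule)
    (fun L => filterlim (qpoch z p) eventually (locally L)).

Definition qbinom (p : C) (M N : nat) : C :=
  if (N <=? M)%nat then qpoch p p M / (qpoch p p N * qpoch p p (M - N)) else 0.

Lemma qpoch_bound (z p : C) (l : nat) : (Cmod p < 1)%R ->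
  (Cmod (qpoch z p l) <= exp (Cmod z * ((1 - Cmod p ^ l) / (1 - Cmod p))))%R.
Proof.
intros Hp.
induction l as [|l IH].
- simpl qpoch. rewrite Cmod_1. simpl.
  replace (Cmod z * ((1 - 1) / (1 - Cmod p)))%R with 0%R by (field; lra).
  rewrite exp_0; lra.
- simpl qpoch. rewrite Cmod_mult.
  replace (Cmod z * ((1 - Cmod p ^ S l) / (1 - Cmod p)))%R
    with (Cmod z * ((1 - Cmod p ^ l) / (1 - Cmod p)) + Cmod z * Cmod p ^ l)%R
    by (simpl; field; lra).
  rewrite exp_plus.
  apply Rmult_le_compat; try apply Cmod_ge_0; [exact IH|].
  apply Rle_trans with (1 + Cmod z * Cmod p ^ l)%R.
  + rewrite <- Cmod_pow, <- Cmod_mult.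
    eapply Rle_trans; [apply Cmod_triangle|].
    rewrite Cmod_opp, Cmod_1; lra.
  + apply exp_ineq1_le.
Qed.

Lemma qpoch_inf_correct (z p : C) : (Cmod p < 1)%R ->
  filterlim (qpoch z p) eventually (locally (qpoch_inf z p)).
Proof.
intros Hp.
assert (Hp0 := Cmod_ge_0 p).
assert (Hz0 := Cmod_ge_0 z).
set (B := exp (Cmod z * (1 / (1 - Cmod p)))%R).
assert (HB : forall l, (Cmod (qpoch z p l) <= B)%R).
{ intros l. eapply Rle_trans; [apply qpoch_bound, Hp|].
  assert (Hl : (0 <= Cmod p ^ l)%R) by (apply pow_le; lra).
  assert (Hexp : forall x y, (x <= y -> exp x <= exp y)%R).
  { intros x y [Hxy | ->]; [left; now apply exp_increasing | right; reflexivity]. }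
  apply Hexp, Rmult_le_compat_l; [lra|].
  apply Rmult_le_compat_r; [|lra].
  left; apply Rinv_0_lt_compat; lra. }
set (a := fun l => - (qpoch z p l * (z * p ^ l)) : C).
assert (Ha : ex_series a).
{ apply (ex_series_le (V := C_CompleteNormedModule) a
    (fun l => scal (B * Cmod z)%R (Cmod p ^ l)%R)).
  - intros l. change (norm (a l)) with (Cmod (a l)). unfold a.
    rewrite Cmod_opp, !Cmod_mult, Cmod_pow.
    change (scal (B * Cmod z)%R (Cmod p ^ l)%R)
      with (B * Cmod z * Cmod p ^ l)%R.
    rewrite Rmult_assoc.
    apply Rmult_le_compat_r; [|apply HB].
    apply Rmult_le_pos; [lra|apply pow_le; lra].
  - apply @ex_series_scal_l, ex_series_geom.
    rewrite Rabs_pos_eq; lra. }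
destruct Ha as [s Hs].
assert (Hsum : forall l, qpoch z p (S l) = 1 + sum_n a l).
{ induction l as [|l IH].
  - rewrite sum_O. unfold a. simpl. ring.
  - rewrite sum_Sn.
    change (plus (sum_n a l) (a (S l))) with (sum_n a l + a (S l)).
    rewrite Cplus_assoc, <- IH.
    change (qpoch z p (S (S l)))
      with (qpoch z p (S l) * (1 - z * p ^ S l)).
    unfold a. ring. }
assert (HL : filterlim (qpoch z p) eventually (locally (1 + s))).
{ intros P HP.
  assert (H : filterlim (fun l => 1 + sum_n a l) eventually
                (locally (1 + s))).
  { apply (filterlim_comp_2 (G := locally (RtoC 1)) (H := locally s)
             (fun _ => RtoC 1) (sum_n a) Cplus).
    - apply filterlim_const.
    - exact Hs.
    - apply (filterlim_plus (V := C_NormedModule) (RtoC 1) s). }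
  destruct (H P HP) as [N HN].
  exists (S N). intros [|l] Hl; [lia|].
  unfold filtermap. rewrite Hsum. apply HN; lia. }
assert (E : qpoch_inf z p = 1 + s).
{ exact (iota_filterlim_locally (V := C_CompleteNormedModule) _ _ HL). }
rewrite E. exact HL.
Qed.

(* Main.v *)
Require Import Defs.
From Stdlib Require Import Reals Lra Lia Arith.
From Coquelicot Require Import Coquelicot.
Open Scope C_scope.

(** Write p = q^2, u_i = (q;p)_i / (p;p)_i, x = p^(n+1) and
    P = (q;p)_oo / (p;p)_oo.  With k = n+1+i the q-binomial coefficient cancels
    most of the summand, and the right-hand side becomes
<<
      1 - (q;p)_{n+1} / (p;p)_n * q^((n+1)(2n+1)) * S(x),
      S(x) = sum_i u_i x^i / (1 - x p^i).
>>
    The identity then follows by induction on n ([theta_lambert]).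

    For n = 0 the partial products of P are exactly the partial sums of the
    right-hand side ([lambert_base]).

    Passing from n to n+1 replaces x by x p, and the left-hand side grows by
    P (q^((n+1)(2n+1)) + q^((n+1)(2n+3))) = P q^((n+1)(2n+1)) (1 + x).  What is
    needed is therefore a relation between S(x) and S(x p), namely
<<
      (1 - x) S(x) - q x^2 (1 - q x) S(x p) = (1 - x^2) A(x),
      A(x) = sum_i u_i x^i
>>
    ([lambert_shift]), and the value of A at x = p^(n+1), which makes
    (q;p)_{n+1} / (p;p)_n * A(p^(n+1)) equal to P ([q_binomial_pow], a case of
    the q-binomial theorem).

    Each of these facts is a telescoping sum: the summand of the relation is
    G (i+1) - G i for an explicit G whose limit is known
    ([is_series_telescope]).  The only analysis is that u_i is bounded, which
    gives all the convergence and vanishing of boundary terms, and that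
    (p;p)_oo is nonzero; both come from a uniform bound on 1 / (z;p)_l
    ([qpoch_inv_bound]). *)

(** * Limits and series of complex numbers *)

Definition Clim (u : nat -> C) (L : C) : Prop :=
  filterlim u eventually (locally (T := C_UniformSpace) L).

(** Reduces complex limits to real ones, where squeezing is available.  The
    two metrics that the complex numbers carry, the product one and the one of
    the modulus, have to be exchanged here. *)
Lemma Clim_Cmod (u : nat -> C) (L : C) :
  Clim u L <-> is_lim_seq (fun i => Cmod (u i - L)) 0%R.
Proof.
split.
- intros H. apply is_lim_seq_spec. intros eps.
  assert (HL : locally (T := C_UniformSpace) L (fun y => (Cmod (y - L) < eps)%R)).
  { apply locally_C. exists eps. intros y Hy. exact Hy. }
  destruct (H _ HL) as [N HN]. exists N. intros i Hi.
  rewrite Rminus_0_r, Rabs_pos_eq by apply Cmod_ge_0. now apply HN.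
- intros H P HP. apply locally_C in HP. destruct HP as [eps HP].
  apply is_lim_seq_spec in H. destruct (H eps) as [N HN].
  exists N. intros i Hi. apply HP.
  specialize (HN i Hi).
  rewrite Rminus_0_r, Rabs_pos_eq in HN by apply Cmod_ge_0. exact HN.
Qed.

Lemma Clim_unique (u : nat -> C) (L M : C) : Clim u L -> Clim u M -> L = M.
Proof.
exact (filterlim_locally_unique (V := C_NormedModule) u L M).
Qed.

Lemma Clim_ext (u v : nat -> C) (L : C) :
  (forall i, u i = v i) -> Clim u L -> Clim v L.
Proof. intros H. apply filterlim_ext. exact H. Qed.

Lemma Clim_const (c : C) : Clim (fun _ => c) c.
Proof. apply filterlim_const. Qed.

Lemma Clim_S (u : nat -> C) (L : C) : Clim u L -> Clim (fun i => u (S i)) L.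
Proof.
intros H P HP. destruct (H P HP) as [N HN].
exists N. intros i Hi. apply HN. lia.
Qed.

Lemma Clim_minus (u v : nat -> C) (L M : C) :
  Clim u L -> Clim v M -> Clim (fun i => u i - v i) (L - M).
Proof.
rewrite !Clim_Cmod. intros Hu Hv.
apply is_lim_seq_le_le with (u := fun _ => 0%R)
  (w := fun i => (Cmod (u i - L) + Cmod (v i - M))%R).
- intros i. split; [apply Cmod_ge_0|].
  replace (u i - v i - (L - M)) with ((u i - L) + - (v i - M)) by ring.
  rewrite <- (Cmod_opp (v i - M)). apply Cmod_triangle.
- apply is_lim_seq_const.
- replace (Finite 0) with (Finite (0 + 0)) by (f_equal; ring).
  now apply is_lim_seq_plus'.
Qed.

Lemma Clim_mult (u v : nat -> C) (L M : C) :
  Clim u L -> Clim v M -> Clim (fun i => u i * v i) (L * M).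
Proof.
rewrite !Clim_Cmod. intros Hu Hv.
apply is_lim_seq_le_le with (u := fun _ => 0%R)
  (w := fun i => (Cmod (u i - L) * Cmod (v i - M) + Cmod (u i - L) * Cmod M
                  + Cmod L * Cmod (v i - M))%R).
- intros i. split; [apply Cmod_ge_0|].
  replace (u i * v i - L * M)
    with ((u i - L) * (v i - M) + (u i - L) * M + L * (v i - M)) by ring.
  rewrite <- !Cmod_mult.
  eapply Rle_trans; [apply Cmod_triangle|].
  apply Rplus_le_compat_r, Cmod_triangle.
- apply is_lim_seq_const.
- replace (Finite 0) with (Finite (0 * 0 + 0 * Cmod M + Cmod L * 0))
    by (f_equal; ring).
  repeat apply is_lim_seq_plus'; apply is_lim_seq_mult';
    trivial; apply is_lim_seq_const.
Qed.

Lemma Clim_bounded_geom (c : nat -> C) (B : R) (x : C) :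
  (forall i, (Cmod (c i) <= B)%R) -> (Cmod x < 1)%R ->
  Clim (fun i => c i * x ^ i) 0.
Proof.
intros Hc Hx. apply Clim_Cmod.
apply is_lim_seq_le_le with (u := fun _ => 0%R) (w := fun i => (B * Cmod x ^ i)%R).
- intros i. split; [apply Cmod_ge_0|].
  replace (c i * x ^ i - 0) with (c i * x ^ i) by ring.
  rewrite Cmod_mult, Cmod_pow.
  apply Rmult_le_compat_r; [apply pow_le, Cmod_ge_0|apply Hc].
- apply is_lim_seq_const.
- replace (Finite 0) with (Finite (B * 0)) by (f_equal; ring).
  apply is_lim_seq_mult'; [apply is_lim_seq_const|].
  apply is_lim_seq_geom. now rewrite Rabs_pos_eq by apply Cmod_ge_0.
Qed.

Lemma ex_series_bounded_geom (c : nat -> C) (B : R) (x : C) :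
  (forall i, (Cmod (c i) <= B)%R) -> (Cmod x < 1)%R ->
  exists s : C, is_series (fun i => c i * x ^ i) s.
Proof.
intros Hc Hx.
apply (ex_series_le (V := C_CompleteNormedModule) (fun i => c i * x ^ i)
  (fun i => scal B (Cmod x ^ i)%R)).
- intros i. change (Cmod (c i * x ^ i) <= B * Cmod x ^ i)%R.
  rewrite Cmod_mult, Cmod_pow.
  apply Rmult_le_compat_r; [apply pow_le, Cmod_ge_0|apply Hc].
- apply @ex_series_scal_l, ex_series_geom.
  now rewrite Rabs_pos_eq by apply Cmod_ge_0.
Qed.

Lemma is_series_Cscal (c : C) (a : nat -> C) (l : C) :
  is_series a l -> is_series (fun i => c * a i) (c * l).
Proof. exact (is_series_scal c a l). Qed.

Lemma is_series_Cminus (a b : nat -> C) (l m : C) :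
  is_series a l -> is_series b m -> is_series (fun i => a i - b i) (l - m).
Proof. exact (is_series_minus a b l m). Qed.

Lemma sum_n_telescope (F G : nat -> C) (N : nat) :
  (forall i, F i = G (S i) - G i) -> sum_n F N = G (S N) - G O.
Proof.
intros H. induction N as [|N IH].
- now rewrite sum_O, H.
- rewrite sum_Sn, IH, H.
  change (G (S N) - G O + (G (S (S N)) - G (S N)) = G (S (S N)) - G O). ring.
Qed.

Lemma is_series_telescope (F G : nat -> C) (s L : C) :
  is_series F s -> (forall i, F i = G (S i) - G i) -> Clim G L -> s = L - G O.
Proof.
intros Hs HF HG.
apply (Clim_unique (sum_n F)); [exact Hs|].
apply (Clim_ext (fun N => G (S N) - G O)).
- intros N. symmetry. now apply sum_n_telescope.
- apply Clim_minus; [now apply Clim_S|apply Clim_const].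
Qed.

(** * Bounds on q-Pochhammer symbols *)

Lemma one_minus_bound (z : C) : (1 - Cmod z <= Cmod (1 - z))%R.
Proof.
assert (H := Cmod_triangle (1 - z) z).
replace (1 - z + z) with (RtoC 1) in H by ring.
rewrite Cmod_1 in H. lra.
Qed.

Lemma one_minus_neq0 (z : C) : (Cmod z < 1)%R -> 1 - z <> 0.
Proof.
intros Hz E. assert (H := one_minus_bound z). rewrite E, Cmod_0 in H. lra.
Qed.

Lemma Cmod_mul_pow_le (x p : C) (i : nat) :
  (Cmod p < 1)%R -> (Cmod (x * p ^ i) <= Cmod x)%R.
Proof.
intros Hp. rewrite Cmod_mult, Cmod_pow.
rewrite <- (Rmult_1_r (Cmod x)) at 2.
apply Rmult_le_compat_l; [apply Cmod_ge_0|].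
rewrite <- (pow1 i). apply pow_incr. split; [apply Cmod_ge_0|lra].
Qed.

Lemma Cmod_pow_S_lt1 (p : C) (n : nat) :
  (Cmod p < 1)%R -> (Cmod (p ^ S n) < 1)%R.
Proof.
intros Hp. rewrite Cpow_S.
eapply Rle_lt_trans; [now apply Cmod_mul_pow_le|exact Hp].
Qed.

Lemma one_minus_mul_pow_neq0 (x p : C) (i : nat) :
  (Cmod x < 1)%R -> (Cmod p < 1)%R -> 1 - x * p ^ i <> 0.
Proof.
intros Hx Hp. apply one_minus_neq0.
eapply Rle_lt_trans; [now apply Cmod_mul_pow_le|exact Hx].
Qed.

Lemma inv_one_minus_bound (x p : C) (i : nat) :
  (Cmod x < 1)%R -> (Cmod p < 1)%R ->
  (Cmod (/ (1 - x * p ^ i)) <= / (1 - Cmod x))%R.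
Proof.
intros Hx Hp.
rewrite Cmod_inv by now apply one_minus_mul_pow_neq0.
apply Rinv_le_contravar; [lra|].
eapply Rle_trans; [|apply one_minus_bound].
assert (H := Cmod_mul_pow_le x p i Hp). lra.
Qed.

Lemma qpoch_neq0 (z p : C) (l : nat) :
  (Cmod z < 1)%R -> (Cmod p < 1)%R -> qpoch z p l <> 0.
Proof.
intros Hz Hp. induction l as [|l IH]; simpl.
- exact C1_nz.
- apply Cmult_neq_0; [exact IH|now apply one_minus_mul_pow_neq0].
Qed.

(** Each factor satisfies |1/(1-w)| <= 1 + |w|/(1-|z|) <= exp (|w|/(1-|z|)) with
    w = z p^l, and the exponents add up to a geometric sum; so the bound stays
    finite as l grows. *)
Lemma qpoch_inv_bound (z p : C) (l : nat) :
  (Cmod z < 1)%R -> (Cmod p < 1)%R ->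
  (Cmod (/ qpoch z p l)
    <= exp (Cmod z / (1 - Cmod z) * ((1 - Cmod p ^ l) / (1 - Cmod p))))%R.
Proof.
intros Hz Hp.
induction l as [|l IH].
- simpl. replace (/ 1) with (RtoC 1) by (field; exact C1_nz). rewrite Cmod_1.
  replace (Cmod z / (1 - Cmod z) * ((1 - 1) / (1 - Cmod p)))%R with 0%R
    by (field; lra).
  rewrite exp_0; lra.
- assert (Hl := qpoch_neq0 z p l Hz Hp).
  assert (H1 := one_minus_mul_pow_neq0 z p l Hz Hp).
  simpl qpoch.
  replace (/ (qpoch z p l * (1 - z * p ^ l)))
    with (/ qpoch z p l * / (1 - z * p ^ l)) by (field; now split).
  rewrite Cmod_mult.
  replace (Cmod z / (1 - Cmod z) * ((1 - Cmod p ^ S l) / (1 - Cmod p)))%R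
    with (Cmod z / (1 - Cmod z) * ((1 - Cmod p ^ l) / (1 - Cmod p))
          + Cmod z * Cmod p ^ l * / (1 - Cmod z))%R
    by (simpl; field; lra).
  rewrite exp_plus.
  apply Rmult_le_compat; try apply Cmod_ge_0; [exact IH|].
  apply Rle_trans with (1 + Cmod z * Cmod p ^ l * / (1 - Cmod z))%R;
    [|apply exp_ineq1_le].
  replace (/ (1 - z * p ^ l)) with (1 + z * p ^ l * / (1 - z * p ^ l))
    by (field; exact H1).
  eapply Rle_trans; [apply Cmod_triangle|].
  rewrite Cmod_1, Cmod_mult, Cmod_mult, Cmod_pow.
  apply Rplus_le_compat_l, Rmult_le_compat_l.
  + apply Rmult_le_pos; [apply Cmod_ge_0|apply pow_le, Cmod_ge_0].
  + now apply inv_one_minus_bound.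
Qed.

Lemma geom_partial_le (r A : R) (l : nat) : (0 <= r < 1)%R -> (0 <= A)%R ->
  (exp (A * ((1 - r ^ l) / (1 - r))) <= exp (A / (1 - r)))%R.
Proof.
intros Hr HA.
assert (Hl : (0 <= r ^ l)%R) by (apply pow_le; lra).
assert (H : (A * ((1 - r ^ l) / (1 - r)) <= A / (1 - r))%R).
{ unfold Rdiv. apply Rmult_le_compat_l; [exact HA|].
  rewrite <- (Rmult_1_l (/ (1 - r))) at 2.
  apply Rmult_le_compat_r; [|lra].
  left; apply Rinv_0_lt_compat; lra. }
destruct H as [H | ->]; [left; now apply exp_increasing | right; reflexivity].
Qed.

Lemma qpoch_inv_bounded (z p : C) : (Cmod z < 1)%R -> (Cmod p < 1)%R ->
  exists B : R, forall l, (Cmod (/ qpoch z p l) <= B)%R.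
Proof.
intros Hz Hp.
exists (exp (Cmod z / (1 - Cmod z) / (1 - Cmod p)))%R. intros l.
eapply Rle_trans; [now apply qpoch_inv_bound|].
apply geom_partial_le; [split; [apply Cmod_ge_0|exact Hp]|].
apply Rmult_le_pos; [apply Cmod_ge_0|].
left; apply Rinv_0_lt_compat; lra.
Qed.

(** If the product tended to 0, so would its product with its bounded inverse,
    which is constantly 1. *)
Lemma qpoch_inf_neq0 (z p : C) :
  (Cmod z < 1)%R -> (Cmod p < 1)%R -> qpoch_inf z p <> 0.
Proof.
intros Hz Hp E.
destruct (qpoch_inv_bounded z p Hz Hp) as [B HB].
assert (H := qpoch_inf_correct z p Hp). rewrite E in H.
apply Clim_Cmod, (is_lim_seq_scal_l _ B) in H.
replace (Rbar_mult B 0) with (Finite 0) in H by (simpl; f_equal; ring).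
assert (H1 : Rbar_le 1%R 0%R).
{ apply (is_lim_seq_le (fun _ => 1%R) _ _ _) with (2 := is_lim_seq_const 1%R)
    (3 := H).
  intros l. rewrite <- Cmod_1.
  replace (RtoC 1) with (/ qpoch z p l * (qpoch z p l - 0))
    by (field; now apply qpoch_neq0).
  rewrite Cmod_mult. apply Rmult_le_compat_r; [apply Cmod_ge_0|apply HB]. }
simpl in H1. lra.
Qed.

(** * The q-binomial series *)

Definition qratio (a p : C) (i : nat) : C := qpoch a p i / qpoch p p i.

Lemma qratio_S (a p : C) (i : nat) : (Cmod p < 1)%R ->
  qratio a p (S i) = qratio a p i * (1 - a * p ^ i) / (1 - p * p ^ i).
Proof.
intros Hp. unfold qratio. simpl. field. split.
- now apply qpoch_neq0.
- now apply one_minus_mul_pow_neq0.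
Qed.

Lemma qratio_bounded (a p : C) : (Cmod p < 1)%R ->
  exists B : R, forall i, (Cmod (qratio a p i) <= B)%R.
Proof.
intros Hp. destruct (qpoch_inv_bounded p p Hp Hp) as [B HB].
exists (exp (Cmod a / (1 - Cmod p)) * B)%R. intros i.
unfold qratio, Cdiv. rewrite Cmod_mult.
apply Rmult_le_compat; try apply Cmod_ge_0; [|apply HB].
eapply Rle_trans; [now apply qpoch_bound|].
apply geom_partial_le; [split; [apply Cmod_ge_0|exact Hp]|apply Cmod_ge_0].
Qed.

Lemma qratio_lim (a p : C) : (Cmod p < 1)%R ->
  Clim (qratio a p) (qpoch_inf a p / qpoch_inf p p).
Proof.
intros Hp.
assert (Hinf := qpoch_inf_neq0 p p Hp Hp).
destruct (qpoch_inv_bounded p p Hp Hp) as [B HB].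
apply Clim_Cmod.
assert (Ha := qpoch_inf_correct a p Hp).
assert (Hb := qpoch_inf_correct p p Hp).
set (A := qpoch_inf a p) in *. set (D := qpoch_inf p p) in *.
assert (H := Clim_minus _ _ _ _ Ha (Clim_mult _ _ _ _ (Clim_const (A / D)) Hb)).
apply Clim_Cmod, (is_lim_seq_scal_l _ B) in H.
replace (Rbar_mult B 0) with (Finite 0) in H by (simpl; f_equal; ring).
apply is_lim_seq_le_le with (2 := is_lim_seq_const 0%R) (3 := H).
intros i. split; [apply Cmod_ge_0|].
unfold qratio.
replace (qpoch a p i / qpoch p p i - A / D)
  with (/ qpoch p p i * (qpoch a p i - A / D * qpoch p p i - (A - A / D * D)))
  by (field; split; [exact Hinf|now apply qpoch_neq0]).
rewrite Cmod_mult. apply Rmult_le_compat_r; [apply Cmod_ge_0|apply HB].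
Qed.

Lemma q_binomial_ex (a p x : C) : (Cmod p < 1)%R -> (Cmod x < 1)%R ->
  exists s : C, is_series (fun i => qratio a p i * x ^ i) s.
Proof.
intros Hp Hx. destruct (qratio_bounded a p Hp) as [B HB].
now apply (ex_series_bounded_geom _ B).
Qed.

(** The functional equation behind the q-binomial theorem.  The recurrence
    u_{i+1} (1 - p^{i+1}) = u_i (1 - a p^i) makes the difference of the two sides
    telescope along -u_i x^i (1 - p^i). *)
Lemma q_binomial_shift (a p x s t : C) : (Cmod p < 1)%R -> (Cmod x < 1)%R ->
  is_series (fun i => qratio a p i * x ^ i) s ->
  is_series (fun i => qratio a p i * (x * p) ^ i) t ->
  (1 - x) * s = (1 - a * x) * t.
Proof.
intros Hp Hx Hs Ht.
destruct (qratio_bounded a p Hp) as [B HB].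
set (G := fun i => - (qratio a p i * x ^ i - qratio a p i * (x * p) ^ i)).
assert (HG : Clim G (0 - 0)).
{ apply (Clim_ext (fun i => qratio a p i * (x * p) ^ i - qratio a p i * x ^ i)).
  - intros i. unfold G. ring.
  - apply Clim_minus; apply (Clim_bounded_geom _ B); trivial.
    rewrite Cmod_mult, <- (Rmult_1_r 1).
    apply Rmult_le_0_lt_compat; trivial; apply Cmod_ge_0. }
assert (E : (1 - x) * s - (1 - a * x) * t = 0 - 0 - G O).
{ refine (is_series_telescope _ G _ _
    (is_series_Cminus _ _ _ _ (is_series_Cscal (1 - x) _ _ Hs)
      (is_series_Cscal (1 - a * x) _ _ Ht)) _ HG).
  intros i. unfold G. rewrite (qratio_S a p i Hp), !Cpow_mult_l, !Cpow_S.
  field. now apply one_minus_mul_pow_neq0. }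
replace ((1 - x) * s)
  with ((1 - x) * s - (1 - a * x) * t + (1 - a * x) * t) by ring.
rewrite E. unfold G. simpl. ring.
Qed.

(** The q-binomial theorem at the powers of p only, where a finite number of
    shifts leads back to x = p.  There the partial sums are explicit:
    (1 - a) (u_0 + u_1 p + ... + u_N p^N) = u_{N+1} (1 - p^{N+1}). *)
Lemma q_binomial_pow (a p s : C) (n : nat) : (Cmod p < 1)%R ->
  is_series (fun i => qratio a p i * (p ^ S n) ^ i) s ->
  qpoch a p (S n) / qpoch p p n * s = qpoch_inf a p / qpoch_inf p p.
Proof.
intros Hp. revert s. induction n as [|n IH]; intros s Hs.
- apply (Clim_unique (qratio a p)); [|now apply qratio_lim].
  replace (qpoch a p 1 / qpoch p p 0 * s) with ((1 - a) * s)
    by (simpl; field; exact C1_nz).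
  set (G := fun i => qratio a p i * (1 - p ^ i)).
  assert (HF : forall i, (1 - a) * (qratio a p i * (p ^ 1) ^ i) = G (S i) - G i).
  { intros i. unfold G. rewrite (qratio_S a p i Hp), Cpow_1_r, Cpow_S. field.
    now apply one_minus_mul_pow_neq0. }
  assert (HG : Clim G (qpoch_inf a p / qpoch_inf p p * (1 - 0))).
  { apply Clim_mult; [now apply qratio_lim|].
    apply Clim_minus; [apply Clim_const|].
    apply (Clim_ext (fun i => 1 * p ^ i)); [intros i; ring|].
    apply (Clim_bounded_geom _ 1); [|exact Hp].
    intros _. rewrite Cmod_1. lra. }
  rewrite (is_series_telescope _ G _ _ (is_series_Cscal (1 - a) _ _ Hs) HF HG).
  replace (qpoch_inf a p / qpoch_inf p p * (1 - 0) - G O)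
    with (qpoch_inf a p / qpoch_inf p p) by (unfold G; simpl; ring).
  now apply qratio_lim.
- assert (Hx := Cmod_pow_S_lt1 p n Hp).
  destruct (q_binomial_ex a p (p ^ S n) Hp Hx) as [t Ht].
  rewrite <- (IH t Ht).
  assert (E : (1 - p ^ S n) * t = (1 - a * p ^ S n) * s).
  { apply (q_binomial_shift a p); trivial.
    eapply is_series_ext; [|exact Hs]. intros i. simpl.
    do 2 f_equal. ring. }
  assert (Hn := qpoch_neq0 p p n Hp Hp).
  assert (H1 := one_minus_neq0 _ Hx).
  change (qpoch a p (S (S n))) with (qpoch a p (S n) * (1 - a * p ^ S n)).
  change (qpoch p p (S n)) with (qpoch p p n * (1 - p ^ S n)).
  transitivity (qpoch a p (S n) * ((1 - a * p ^ S n) * s)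
    / (qpoch p p n * (1 - p ^ S n))); [field; now split|].
  rewrite <- E. field. now split.
Qed.

(** * The Lambert-type series *)

Definition lambert_term (a p x : C) (i : nat) : C :=
  qratio a p i * x ^ i / (1 - x * p ^ i).

Lemma lambert_coef_bounded (a p x : C) : (Cmod p < 1)%R -> (Cmod x < 1)%R ->
  exists B, forall i, (Cmod (qratio a p i / (1 - x * p ^ i)) <= B)%R.
Proof.
intros Hp Hx. destruct (qratio_bounded a p Hp) as [B HB].
exists (B * / (1 - Cmod x))%R. intros i.
unfold Cdiv. rewrite Cmod_mult.
apply Rmult_le_compat; try apply Cmod_ge_0; [apply HB|].
now apply inv_one_minus_bound.
Qed.

Lemma lambert_ex (a p x : C) : (Cmod p < 1)%R -> (Cmod x < 1)%R ->
  exists s : C, is_series (lambert_term a p x) s.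
Proof.
intros Hp Hx. destruct (lambert_coef_bounded a p x Hp Hx) as [B HB].
destruct (ex_series_bounded_geom _ B x HB Hx) as [s Hs].
exists s. eapply is_series_ext; [|exact Hs].
intros i. unfold lambert_term, Cdiv. simpl. ring.
Qed.

(** The three series combine termwise into G (i+1) - G i with
    G i = u_i x^{i+1} (1 - p^i) / (1 - x p^i).  Indeed
    (1-x)/(1-x p^i) - 1 = - x (1-p^i)/(1-x p^i) accounts for - G i, and
    x^2 - q x^2 (1 - q x) p^i / (1 - x p^{i+1}) = x^2 (1 - q p^i)/(1 - x p^{i+1})
    accounts for G (i+1); the last equality holds because the terms
    - x p^{i+1} and q^2 x p^i cancel, that is, because p = q^2. *)
Lemma lambert_shift (q x s t b : C) : (Cmod q < 1)%R -> (Cmod x < 1)%R ->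
  is_series (lambert_term q (q ^ 2) x) s ->
  is_series (lambert_term q (q ^ 2) (x * q ^ 2)) t ->
  is_series (fun i => qratio q (q ^ 2) i * x ^ i) b ->
  (1 - x) * s - q * x ^ 2 * (1 - q * x) * t = (1 - x ^ 2) * b.
Proof.
intros Hq Hx Hs Ht Hb.
assert (Hp := Cmod_pow_S_lt1 q 1 Hq).
set (p := q ^ 2) in *.
destruct (lambert_coef_bounded q p x Hp Hx) as [B HB].
(* The factor 1 in 1 * p ^ i is the coefficient expected by Clim_bounded_geom. *)
set (G := fun i => (qratio q p i / (1 - x * p ^ i)) * x ^ i * (x * (1 - 1 * p ^ i))).
assert (HG : Clim G (0 * (x * (1 - 0)))).
{ apply Clim_mult; [now apply (Clim_bounded_geom _ B)|].
  apply Clim_mult; [apply Clim_const|].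
  apply Clim_minus; [apply Clim_const|].
  apply (Clim_bounded_geom _ 1); [|exact Hp].
  intros _. rewrite Cmod_1. lra. }
assert (E : (1 - x) * s - q * x ^ 2 * (1 - q * x) * t - (1 - x ^ 2) * b
            = 0 * (x * (1 - 0)) - G O).
{ refine (is_series_telescope _ G _ _
    (is_series_Cminus _ _ _ _
      (is_series_Cminus _ _ _ _ (is_series_Cscal (1 - x) _ _ Hs)
        (is_series_Cscal (q * x ^ 2 * (1 - q * x)) _ _ Ht))
      (is_series_Cscal (1 - x ^ 2) _ _ Hb)) _ HG).
  intros i. unfold G, lambert_term. rewrite (qratio_S q p i Hp).
  assert (H1 := one_minus_mul_pow_neq0 x p i Hx Hp).
  assert (H2 := one_minus_mul_pow_neq0 x p (S i) Hx Hp).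
  assert (H3 := one_minus_mul_pow_neq0 p p i Hp Hp).
  rewrite !Cpow_mult_l, !Cpow_S in *.
  set (P := p ^ i) in *. unfold p in *. simpl in *.
  field.
  repeat split; intros E;
    first [apply H1; rewrite <- E; ring | apply H2; rewrite <- E; ring
          | apply H3; rewrite <- E; ring]. }
replace ((1 - x ^ 2) * b) with ((1 - x ^ 2) * b + (0 * (x * (1 - 0)) - G O))
  by (unfold G; simpl; ring).
rewrite <- E. ring.
Qed.

(** With p = q^2 one has
    (1 - p^{i+1}) - (1 - q p^i) = q (1 - q) p^i, so the series is, up to the
    factor - q (1 - q), the sum of the increments u_{i+1} - u_i. *)
Lemma lambert_base (q s : C) : (Cmod q < 1)%R ->
  is_series (lambert_term q (q ^ 2) (q ^ 2)) s ->
  qpoch_inf q (q ^ 2) / qpoch_inf (q ^ 2) (q ^ 2) = 1 - (1 - q) * q * s.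
Proof.
intros Hq Hs.
assert (Hp := Cmod_pow_S_lt1 q 1 Hq).
assert (E : - ((1 - q) * q) * s =
  qpoch_inf q (q ^ 2) / qpoch_inf (q ^ 2) (q ^ 2) - qratio q (q ^ 2) 0).
{ refine (is_series_telescope _ (qratio q (q ^ 2)) _ _
    (is_series_Cscal (- ((1 - q) * q)) _ _ Hs) _ (qratio_lim _ _ Hp)).
  intros i. unfold lambert_term. rewrite (qratio_S _ _ i Hp).
  assert (H1 := one_minus_mul_pow_neq0 (q ^ 2) (q ^ 2) i Hp Hp).
  set (P := (q ^ 2) ^ i) in *. simpl in *. field.
  intros E. apply H1. rewrite <- E. ring. }
replace (1 - (1 - q) * q * s) with (1 + - ((1 - q) * q) * s) by ring.
rewrite E. unfold qratio. simpl qpoch. field.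
now apply qpoch_inf_neq0.
Qed.

(** * The partial theta sum *)

Lemma triangular_S (j : nat) :
  (S j * (S j + 1) / 2 = j * (j + 1) / 2 + S j)%nat.
Proof.
replace (S j * (S j + 1))%nat with (j * (j + 1) + S j * 2)%nat by lia.
now rewrite Nat.div_add by lia.
Qed.

Lemma triangular_odd (n : nat) :
  (S (2 * n) * (S (2 * n) + 1) / 2 = S n * (2 * n + 1))%nat.
Proof.
replace (S (2 * n) * (S (2 * n) + 1))%nat with (S n * (2 * n + 1) * 2)%nat by lia.
now rewrite Nat.div_mul by lia.
Qed.

(** Induction on n; the two new terms of the sum have exponents (n+1)(2n+1) and
    (n+1)(2n+1) + 2(n+1), and (q^2)^(n+1) = x. *)
Lemma theta_lambert (q : C) (n : nat) (s : C) : (Cmod q < 1)%R ->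
  is_series (lambert_term q (q ^ 2) ((q ^ 2) ^ S n)) s ->
  qpoch_inf q (q ^ 2) / qpoch_inf (q ^ 2) (q ^ 2)
    * sum_n (fun j : nat => q ^ (j * (j + 1) / 2)) (2 * n)
  = 1 - qpoch q (q ^ 2) (S n) / qpoch (q ^ 2) (q ^ 2) n
        * q ^ (S n * (2 * n + 1)) * s.
Proof.
intros Hq.
assert (Hp := Cmod_pow_S_lt1 q 1 Hq).
revert s. induction n as [|n IH]; intros t Ht.
- rewrite Cpow_1_r in Ht. rewrite (lambert_base q t Hq Ht).
  simpl. rewrite sum_O. simpl. field.
- assert (Hx := Cmod_pow_S_lt1 (q ^ 2) n Hp).
  destruct (lambert_ex q (q ^ 2) ((q ^ 2) ^ S n) Hp Hx) as [s Hs].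
  destruct (q_binomial_ex q (q ^ 2) ((q ^ 2) ^ S n) Hp Hx) as [b Hb].
  assert (Eb := q_binomial_pow _ _ _ _ Hp Hb).
  specialize (IH s Hs).
  assert (E : (1 - (q ^ 2) ^ S n) * s
    - q * ((q ^ 2) ^ S n) ^ 2 * (1 - q * (q ^ 2) ^ S n) * t
    = (1 - ((q ^ 2) ^ S n) ^ 2) * b).
  { apply lambert_shift; trivial.
    rewrite Cmult_comm. rewrite Cpow_S in Ht. exact Ht. }
  replace (2 * S n)%nat with (S (S (2 * n))) by lia.
  rewrite !sum_Sn, (triangular_S (S (2 * n))), triangular_odd.
  match goal with |- ?P * plus (plus ?S ?u) ?v = ?R =>
    change (P * (S + u + v) = R) end.
  rewrite !Cmult_plus_distr_l, IH, <- Eb.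
  assert (Hn := qpoch_neq0 (q ^ 2) (q ^ 2) n Hp Hp).
  assert (H1 := one_minus_neq0 _ Hx).
  change (qpoch q (q ^ 2) (S (S n)))
    with (qpoch q (q ^ 2) (S n) * (1 - q * (q ^ 2) ^ S n)).
  change (qpoch (q ^ 2) (q ^ 2) (S n))
    with (qpoch (q ^ 2) (q ^ 2) n * (1 - (q ^ 2) ^ S n)).
  replace (S (S n) * (S (S (2 * n)) + 1))%nat
    with (S n * (2 * n + 1) + (1 + 2 * S n + 2 * S n))%nat by lia.
  replace (S (S (2 * n))) with (2 * S n)%nat by lia.
  rewrite !Cpow_add_r, Cpow_1_r, !Cpow_mult_r.
  set (x := (q ^ 2) ^ S n) in *.
  set (e := (q ^ S n) ^ (2 * n + 1)) in *.
  set (c := qpoch q (q ^ 2) (S n)) in *.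
  set (d := qpoch (q ^ 2) (q ^ 2) n) in *.
  (* Now the new terms are c b / d times e and e x, and 1 + x = (1 - x^2)/(1 - x). *)
  transitivity (1 - c * e / (d * (1 - x)) * ((1 - x) * s - (1 - x ^ 2) * b)).
  + simpl. field. now split.
  + rewrite <- E. simpl. field. now split.
Qed.

Theorem theorem1p2 (q : C) (hq : (Cmod q < 1)%R) (n : nat) :
  exists s : C,
    is_series (fun i : nat => let k := (n + 1 + i)%nat in
        qpoch q (q ^ 2) (k - n - 1) * q ^ ((2 * n + 2) * k - n - 1)
          / ((1 - q ^ (2 * k)) * qpoch (q ^ 2) (q ^ 2) (k - 1))
          * qbinom (q ^ 2) (k - 1) n) s /\
    qpoch_inf q (q ^ 2) / qpoch_inf (q ^ 2) (q ^ 2)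
      * sum_n (fun j : nat => q ^ (j * (j + 1) / 2)) (2 * n)
    = 1 - qpoch q (q ^ 2) (n + 1) * s.
Proof.
assert (Hp := Cmod_pow_S_lt1 q 1 hq).
assert (Hx := Cmod_pow_S_lt1 (q ^ 2) n Hp).
destruct (lambert_ex q (q ^ 2) ((q ^ 2) ^ S n) Hp Hx) as [s Hs].
exists (q ^ (S n * (2 * n + 1)) / qpoch (q ^ 2) (q ^ 2) n * s). split.
- eapply is_series_ext; [|apply (is_series_Cscal
    (q ^ (S n * (2 * n + 1)) / qpoch (q ^ 2) (q ^ 2) n) _ _ Hs)].
  intros i. cbv zeta.
  replace (n + 1 + i - n - 1)%nat with i by lia.
  replace (n + 1 + i - 1)%nat with (n + i)%nat by lia.
  replace ((2 * n + 2) * (n + 1 + i) - n - 1)%nat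
    with (S n * (2 * n + 1) + 2 * S n * i)%nat by nia.
  replace (2 * (n + 1 + i))%nat with (2 * (S n + i))%nat by lia.
  unfold qbinom. replace (n <=? n + i)%nat with true
    by (symmetry; apply Nat.leb_le; lia).
  replace (n + i - n)%nat with i by lia.
  rewrite (Cpow_mult_r q 2 (S n + i)), !Cpow_add_r.
  rewrite (Cpow_mult_r q (2 * S n) i), (Cpow_mult_r q 2 (S n)).
  assert (H1 := one_minus_mul_pow_neq0 _ _ i Hx Hp).
  unfold lambert_term, qratio.
  match goal with |- ?l = ?r => change (@eq C l r) end.
  field.
  repeat split; trivial; now apply qpoch_neq0.
- rewrite (theta_lambert q n s hq Hs).
  replace (n + 1)%nat with (S n) by lia. unfold Cdiv. ring.
Qed.
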